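(* Let $Q$ be a tree of total length $1$. Let $\overline{v}$ be the supremum, over all connected subsets $S$ of $Q$, of the attacker's expected payoff in the game $\Gamma'_1(Q)$ when the defender uses the centroid strategy, and let $\underline{v}$ be the expected payoff that the attacker's partition strategy guarantees in $\Gamma'_1(Q)$ (its infimum over all locations of the booby trap). Then $$\frac{\overline{v}}{\underline{v}}\le \frac{27}{25}.$$
   Context: A network $Q$ is obtained from a finite connected graph (vertices are called nodes, edges are called arcs) by assigning to each edge $e$ a length $\lambda(e)>0$ and identifying $e$ with an open interval of that length joining its end nodes; $\lambda$ also denotes the resulting length measure on $Q$ (nodes have measure $0$), and $Q$ carries the shortest-path metric. The total length is $\lambda(Q)=1$. A tree is a network whose underlying graph is a tree. The game $\Gamma'_1(Q)$: the defender chooses a point of $Q$ (the location of the single booby trap) and the attacker chooses a connected subset $S\subseteq Q$, without knowing each other's choice. The payoff to the attacker is $\lambda(S)$ if the booby trap is not in $S$, and $0$ otherwise; the attacker maximizes and the defender minimizes the expected payoff. Centroid: for $x\in Q$ let $h(x)$ be the maximum length of a connected component of $Q\setminus\{x\}$. The centroid $x^*$ of the tree is the (unique) point minimizing $h$. Let $a_1\ge a_2\ge\cdots\ge a_n$ be the lengths of the connected components (''component $1$'', ..., ''component $n$'') of $Q\setminus\{x^*\}$; it is the case that $a_1=h(x^* )\le 1/2$ and $n\ge 2$. Centroid strategy of the defender: with probability $p=\frac{4a_1}{1+4a_1^2}$ place the booby trap uniformly at random on $Q$ (according to $\lambda$), and with probability $1-p=\frac{(1-2a_1)^2}{1+4a_1^2}$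 place it at the centroid $x^*$. Partition strategy of the attacker: for a nonempty $S\subseteq\{1,\dots,n\}$, put $D(S)=\sum_{j\notin S}\frac1{a_j}+\frac{1}{\sum_{j\in S}a_j}$ and consider the attacker's mixed strategy that takes the whole of component $i$ with probability $\frac{1/a_i}{D(S)}$ for each $i\notin S$, and takes all components in $S$ together with the centroid with probability $\frac{1/\sum_{j\in S}a_j}{D(S)}$. This strategy guarantees expected payoff $W(S)=\frac{n-|S|}{D(S)}$. The partition strategy is the strategy of this form for a set $S$ maximizing $W(S)$. *)

(* Defs.v *)
From HB Require Import structures.
From mathcomp Require Import all_boot all_order all_algebra.
From mathcomp Require Import all_classical all_reals all_analysis.
From mathcomp Require Import measurable_realfun lra.

Set Implicit Arguments.
Unset Strict Implicit.
Unset Printing Implicit Defensive.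

Import Order.TTheory GRing.Theory Num.Theory.
Import numFieldNormedType.Exports.

Local Open Scope classical_set_scope.
Local Open Scope ring_scope.

(* A finite connected multigraph with positive arc lengths. The pair
   [(src e, tgt e)] fixes an orientation of the arc [e], used only to
   parametrize it; loops and parallel arcs are allowed. *)
Record network (R : realType) := Network {
  node : finType;
  net_arc : finType;
  src : net_arc -> node;
  tgt : net_arc -> node;
  len : net_arc -> R;
  len_gt0 : forall e, 0 < len e;
  node_gt0 : (0 < #|node|)%N;
  node_connected : forall u v,
    connect [rel u v | [exists e, ((src e == u) && (tgt e == v))
                               || ((src e == v) && (tgt e == u))]] u v
}.

Arguments src {R n}.
Arguments tgt {R n}.
Arguments len {R n}.
Arguments len_gt0 {R n}.

(* The points of the network: its nodes, and for each arc [e] an open interval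
   of length [len e]. *)
Variant net_point (R : realType) (Q : network R) : Type :=
| Node of node Q
| Inner (e : net_arc Q) of {t : R | 0 < t < len e}.

Coercion net_point : network >-> Sortclass.

(* The parametrization of the closed arc [e] by [0, len e], extended by
   constants to the whole line. *)
Definition arc_pt (R : realType) (Q : network R) (e : net_arc Q) (t : R) : Q :=
  if insub t is Some u then @Inner R Q e u
  else @Node R Q (if t <= 0 then src e else tgt e).

(* A path from [x] to [y] is a chain of segments of closed arcs, the segment
   [(e, a, b)] running along the arc [e] from parameter [a] to parameter [b]. *)
Fixpoint is_path (R : realType) (Q : network R) (x y : Q)
    (c : seq (net_arc Q * R * R)) : Prop :=
  if c is (e, a, b) :: c' then
    [/\ 0 <= a <= len e, 0 <= b <= len e, arc_pt e a = x
      & is_path (arc_pt e b) y c']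
  else x = y.

Definition path_length (R : realType) (Q : network R)
    (c : seq (net_arc Q * R * R)) : R :=
  \sum_(s <- c) `|s.2 - s.1.2|.

Definition net_dist (R : realType) (Q : network R) (x y : Q) : R :=
  inf [set path_length c | c in [set c | is_path x y c]].

HB.instance Definition _ (R : realType) (Q : network R) :=
  gen_eqMixin (net_point Q).
HB.instance Definition _ (R : realType) (Q : network R) :=
  gen_choiceMixin (net_point Q).
HB.instance Definition _ (R : realType) (Q : network R) :=
  isPointed.Build (net_point Q) (Node (enum_val (Ordinal (node_gt0 Q)))).

Section net_metric.
Context (R : realType) (Q : network R).
Implicit Types (x y z : Q) (e : net_arc Q) (c : seq (net_arc Q * R * R)).

Let min_dist_le (a b c d w : R) : `|a - c| <= w -> `|b - d| <= w ->
  `|Num.min a b - Num.min c d| <= w.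
Proof.
rewrite !ler_norml => /andP[? ?] /andP[? ?].
by case: (leP a b) => ?; case: (leP c d) => ?; apply/andP; split; lra.
Qed.

Let max_dist_le (a b c d w : R) : `|a - c| <= w -> `|b - d| <= w ->
  `|Num.max a b - Num.max c d| <= w.
Proof.
rewrite !ler_norml => /andP[? ?] /andP[? ?].
by case: (leP a b) => ?; case: (leP c d) => ?; apply/andP; split; lra.
Qed.

Lemma arc_pt_le0 e t : t <= 0 -> arc_pt e t = Node (src e).
Proof.
move=> t0; rewrite /arc_pt insubF ?t0//.
by apply/negbTE/negP => /andP[]; rewrite ltNge t0.
Qed.

Lemma arc_pt_ge e t : len e <= t -> arc_pt e t = Node (tgt e).
Proof.
move=> t0; rewrite /arc_pt insubF.
  by rewrite leNgt (lt_le_trans (len_gt0 e) t0).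
by apply/negbTE/negP => /andP[_]; rewrite ltNge t0.
Qed.

Lemma arc_pt0 e : arc_pt e 0 = Node (src e).
Proof. exact: arc_pt_le0. Qed.

Lemma arc_pt1 e : arc_pt e (len e) = Node (tgt e).
Proof. exact: arc_pt_ge. Qed.

Lemma arc_pt_inner e (u : {t : R | 0 < t < len e}) :
  arc_pt e (val u) = Inner u.
Proof. by rewrite /arc_pt valK. Qed.

Lemma path_length_ge0 c : 0 <= path_length c.
Proof. by apply: sumr_ge0 => s _; exact: normr_ge0. Qed.

Lemma is_path_cat x y z c c' :
  is_path x y c -> is_path y z c' -> is_path x z (c ++ c').
Proof.
elim: c x => [x /= -> //|[[e a] b] c IH x /= [ha hb hx hc] hc'].
by split => //; exact: IH.
Qed.

Definition path_rev c := rev [seq (s.1.1, s.2, s.1.2) | s <- c].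

Lemma is_path_rev x y c : is_path x y c -> is_path y x (path_rev c).
Proof.
elim: c x => [x /= -> //|[[e a] b] c IH x /= [ha hb hx hc]].
rewrite /path_rev /= rev_cons -cats1; apply: is_path_cat (IH _ hc) _.
by split.
Qed.

Lemma path_length_rev c : path_length (path_rev c) = path_length c.
Proof.
rewrite /path_length /path_rev (perm_big _ (permEl (perm_rev _))) big_map.
by apply: eq_bigr => s _ /=; rewrite distrC.
Qed.

Lemma path_length_cat c c' :
  path_length (c ++ c') = path_length c + path_length c'.
Proof. by rewrite /path_length big_cat. Qed.

Lemma path_nodes (u v : node Q) : exists c, is_path (Node u) (Node v) c.
Proof.
have /connectP[p] := node_connected u v.
elim: p u => [u _ -> |w p IH u /= /andP[/existsP[e He] pw] vE].
  by exists [::].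
have [c hc] := IH w pw vE.
have le0 := len_gt0 e.
case/orP: He => /andP[/eqP E1 /eqP E2].
- exists ((e, 0, len e) :: c) => /=.
  by rewrite arc_pt0 arc_pt1 E1 E2 !lexx ltW.
- exists ((e, len e, 0) :: c) => /=.
  by rewrite arc_pt0 arc_pt1 E1 E2 !lexx ltW.
Qed.

Lemma path_to_node x : exists v c, is_path x (Node v) c.
Proof.
case: x => [v|e [t ht]]; first by exists v, [::].
exists (src e), [:: (e, t, 0)] => /=; case/andP: (ht) => t0 tl.
rewrite arc_pt0 !lexx (ltW t0) (ltW tl) (ltW (len_gt0 e)); split => //.
by rewrite -(arc_pt_inner (exist _ t ht)).
Qed.

Lemma path_exists x y : exists c, is_path x y c.
Proof.
have [u [c1 h1]] := path_to_node x; have [v [c2 h2]] := path_to_node y.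
have [c hc] := path_nodes u v.
exists (c1 ++ c ++ path_rev c2).
by apply: (is_path_cat h1); apply: (is_path_cat hc); exact: is_path_rev.
Qed.

Lemma path_lengths_has_inf x y :
  has_inf [set path_length c | c in [set c | is_path x y c]].
Proof.
split; first by have [c hc] := path_exists x y; exists (path_length c), c.
by exists 0 => _ [c _ <-]; exact: path_length_ge0.
Qed.

Lemma net_dist_le x y c : is_path x y c -> net_dist x y <= path_length c.
Proof.
move=> hc; apply: ge_inf; first exact: (path_lengths_has_inf x y).2.
by exists c.
Qed.

Lemma net_dist_ge x y m :
  (forall c, is_path x y c -> m <= path_length c) -> m <= net_dist x y.
Proof.
move=> h; apply: lb_le_inf; first exact: (path_lengths_has_inf x y).1.
by move=> _ [c hc <-]; exact: h.
Qed.

Lemma net_dist_ge0 x y : 0 <= net_dist x y.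
Proof. by apply: net_dist_ge => c _; exact: path_length_ge0. Qed.

Lemma net_distxx x : net_dist x x = 0.
Proof.
apply/le_anti; rewrite net_dist_ge0 andbT.
by rewrite (le_trans (net_dist_le (c := [::]) _))// /path_length big_nil.
Qed.

Lemma net_dist_sym x y : net_dist x y = net_dist y x.
Proof.
apply/le_anti/andP; split; apply: net_dist_ge => c hc;
  by rewrite -path_length_rev; apply: net_dist_le; exact: is_path_rev.
Qed.

Lemma net_dist_triangle y x z : net_dist x z <= net_dist x y + net_dist y z.
Proof.
rewrite -lerBlDr; apply: net_dist_ge => c hc; rewrite lerBlDr -lerBlDl.
apply: net_dist_ge => c' hc'; rewrite lerBlDl -path_length_cat.
by apply: net_dist_le; exact: is_path_cat hc hc'.
Qed.

Lemma net_dist_lipschitz (f : Q -> R) :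
  (forall e a b, 0 <= a <= len e -> 0 <= b <= len e ->
     `|f (arc_pt e a) - f (arc_pt e b)| <= `|b - a|) ->
  forall x y, `|f x - f y| <= net_dist x y.
Proof.
move=> fL x y; apply: net_dist_ge => c.
elim: c x => [x /= ->|[[e a] b] c IH x /= [ha hb <- hc]].
  by rewrite subrr normr0 path_length_ge0.
rewrite /path_length big_cons /= (le_trans (ler_distD (f (arc_pt e b)) _ _))//.
by rewrite lerD ?fL ?IH.
Qed.

Lemma net_dist_arc e a b : net_dist (arc_pt e a) (arc_pt e b) <= `|b - a|.
Proof.
pose cl t : R := Num.max 0 (Num.min t (len e)).
have le0 := len_gt0 e.
have clE t : arc_pt e (cl t) = arc_pt e t.
  rewrite /cl; case: (leP t (len e)) => [tl|tl].
    by case: (leP 0 t) => // t0; rewrite !arc_pt_le0// ltW.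
  by rewrite max_r ?arc_pt1 ?arc_pt_ge// ltW.
have clb t : 0 <= cl t <= len e.
  by rewrite /cl le_max lexx /= ge_max ltW//= ge_min lexx orbT.
rewrite -(clE a) -(clE b).
apply: (le_trans (net_dist_le (c := [:: (e, cl a, cl b)]) _)); first by split.
by rewrite /path_length big_seq1 max_dist_le ?min_dist_le// subrr normr0.
Qed.

Lemma net_dist_inner_eq e (u : {t : R | 0 < t < len e}) y :
  net_dist (Inner u) y = 0 -> Inner u = y.
Proof.
move=> d0; have /andP[u0 ul] := valP u.
pose r := Num.min (val u) (len e - val u).
have r0 : 0 < r by rewrite lt_min u0 subr_gt0.
pose f (z : Q) : R := if z is @Inner _ _ e' t then
   if e' == e then Num.min r `|val t - val u| else r else r.
have fE e' a : 0 <= a <= len e' ->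
    f (arc_pt e' a) = if e' == e then Num.min r `|a - val u| else r.
  move=> /andP[a0 al]; rewrite /arc_pt; case: insubP => [t ht <-//|].
  rewrite negb_and -!leNgt /= => ha; case: eqP => // ee; subst e'.
  rewrite min_l//; case/orP: ha => ha.
    have -> : a = 0 by apply/le_anti; rewrite ha a0.
    by rewrite sub0r normrN gtr0_norm// ge_min lexx.
  have -> : a = len e by apply/le_anti; rewrite ha al.
  by rewrite gtr0_norm ?subr_gt0// ge_min lexx orbT.
have fL := @net_dist_lipschitz f.
have {}fL : `|f (Inner u) - f y| <= 0.
  rewrite -d0; apply: fL => e' a b ha hb; rewrite !fE//.
  case: eqP => [_|_]; last by rewrite subrr normr0.
  apply: min_dist_le; first by rewrite subrr normr0.
  by rewrite (le_trans (ler_dist_dist _ _))// opprB addrA subrK distrC.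
move: fL; rewrite normr_le0 subr_eq0 /f eqxx subrr normr0 (min_r (ltW r0)).
have rN0 : 0 = r -> False by move=> rE; rewrite -rE ltxx in r0.
case: y {d0} => [v|e' t] /= /eqP; first by move=> /rN0.
case: eqP => [ee|_]; last by move=> /rN0.
subst e'; case: (leP r) => [_ /rN0//|_ /esym/eqP].
by rewrite normr_eq0 subr_eq0 => /eqP/val_inj ->.
Qed.

Lemma net_dist_eq0 x y : net_dist x y = 0 -> x = y.
Proof.
case: x => [v|e u]; last exact: net_dist_inner_eq.
case: y => [w|e u]; last first.
  by rewrite net_dist_sym => /net_dist_inner_eq ->.
move=> d0; have [->//|vw] := eqVneq v w; exfalso.
pose m : R := \big[Num.min/1]_(e : net_arc Q) len e.
have m0 : 0 < m.
  rewrite /m; elim/big_ind: _ => [|a b a0 b0|e _]; [exact: ltr01| |exact: len_gt0].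
  by rewrite lt_min a0.
have mle e : m <= len e by exact: bigmin_le_cond.
pose f (z : Q) : R := match z with
  | @Node _ _ v' => if v' == v then 0 else m
  | @Inner _ _ e t => Num.min (if src e == v then val t else m)
                    (Num.min m (if tgt e == v then len e - val t else m))
  end.
have fE e a : 0 <= a <= len e -> f (arc_pt e a) =
   Num.min (if src e == v then a else m)
     (Num.min m (if tgt e == v then len e - a else m)).
  move=> /andP[a0 al]; rewrite /arc_pt; case: insubP => [t ht <-//|].
  have le0 := len_gt0 e; have := mle e.
  rewrite negb_and -!leNgt /f => ml; case: (leP a 0) => a0' /= al'.
    have -> : a = 0 by apply/le_anti; rewrite a0 a0'.
    rewrite subr0; case: (_ == v); case: (_ == v);
      by rewrite ?minxx ?(min_l ml) ?min_l// ltW.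
  have -> : a = len e by apply/le_anti; rewrite al al'.
  rewrite subrr; case: (_ == v); case: (_ == v);
    by rewrite ?minxx ?(min_r (ltW m0)) ?(min_r (ltW le0)) ?(min_r ml).
have := @net_dist_lipschitz f.
move=> /(_ _ (Node v) (Node w)); rewrite d0 /= eqxx eq_sym (negbTE vw) sub0r.
rewrite normrN gtr0_norm// => H; suff : m <= 0 by rewrite leNgt m0.
apply: H => e a b ha hb; rewrite !fE//.
apply: min_dist_le; last apply: min_dist_le.
- by case: ifP => _; rewrite ?subrr ?normr0// distrC.
- by rewrite subrr normr0.
- case: ifP => _; last by rewrite subrr normr0.
  by rewrite opprB addrC addrA subrK.
Qed.

End net_metric.

HB.instance Definition _ (R : realType) (Q : network R) :=
  @isMetric.Build R (net_point Q) (@net_dist R Q) (@net_distxx R Q)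
    (@net_dist_eq0 R Q) (@net_dist_sym R Q) (@net_dist_triangle R Q).

Lemma arc_pt_continuous (R : realType) (Q : network R) (e : net_arc Q) :
  continuous (@arc_pt R Q e : R -> Q).
Proof.
move=> t; apply/cvg_ballP => r r0; near=> s.
rewrite ballEmdist /=; apply: le_lt_trans (net_dist_arc _ _ _) _; rewrite distrC.
by near: s; exact: (nbhsx_ballx t (r : R) r0).
Unshelve. all: by end_near. Qed.

HB.instance Definition _ (R : realType) (Q : network R) :=
  Measurable.copy (net_point Q) (g_sigma_algebraType (@open Q)).

Lemma measurable_arc_pt (R : realType) (Q : network R) (e : net_arc Q) :
  measurable_fun [set: R] (@arc_pt R Q e : R -> Q).
Proof.
apply: (measurability (@open Q)) => // _ [U oU <-]; rewrite setTI.
by apply: open_measurable; apply: open_comp oU => t _; exact: arc_pt_continuous.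
Qed.

Section length_section.
Local Open Scope ereal_scope.
Context (R : realType) (Q : network R).

Definition arc_length (e : net_arc Q) (A : set Q) : \bar R :=
  lebesgue_measure (`]0%R, len e[ `&` arc_pt e @^-1` A).

Definition length_measure (A : set Q) : \bar R :=
  \sum_(e : net_arc Q) arc_length e A.

Let measurable_arc (e : net_arc Q) (A : set Q) : measurable A ->
  measurable (`]0%R, len e[%classic `&` arc_pt e @^-1` A).
Proof.
move=> mA; apply: measurableI; first exact: measurable_itv.
by rewrite -[X in measurable X]setTI; exact: measurable_arc_pt.
Qed.

Let length0 : length_measure set0 = 0.
Proof.
by rewrite /length_measure big1// => e _; rewrite /arc_length preimage_set0 setI0.
Qed.

Let arc_length_ge0 e A : 0 <= arc_length e A.
Proof. exact: measure_ge0. Qed.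

Let length_ge0 A : 0 <= length_measure A.
Proof. by apply: sume_ge0 => e _. Qed.

Let length_sigma_additive : semi_sigma_additive length_measure.
Proof.
move=> F mF tF mUF; rewrite [X in _ --> X](_ : _ =
    lim ((fun n => \sum_(0 <= i < n) length_measure (F i)) @ \oo)).
  by apply: is_cvg_ereal_nneg_natsum => k _.
rewrite nneseries_sum//; apply: eq_bigr => /= e _.
rewrite /arc_length preimage_bigcup setI_bigcupr.
apply: measure_semi_bigcup => [i|i j _ _|].
- exact: measurable_arc.
- move=> [t [[_ ti] [_ tj]]]; apply: tF => //.
  by exists (arc_pt e t).
- by apply: bigcup_measurable => i _; exact: measurable_arc.
Qed.

HB.instance Definition _ := isMeasure.Build _ _ _ (length_measure : set Q -> \bar R)
  length0 length_ge0 length_sigma_additive.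

End length_section.

(* [(e, true)] is the arc [e] traversed from [src e] to [tgt e], and
   [(e, false)] is its reverse. *)
Definition dart_src (R : realType) (Q : network R) (d : net_arc Q * bool) :
    node Q :=
  if d.2 then src d.1 else tgt d.1.

Definition dart_tgt (R : realType) (Q : network R) (d : net_arc Q * bool) :
    node Q :=
  if d.2 then tgt d.1 else src d.1.

(* The requirement that the arcs be distinct excludes going back and forth
   along one arc; loops and pairs of parallel arcs are cycles. *)
Definition is_cycle (R : realType) (Q : network R)
    (c : seq (net_arc Q * bool)) : Prop :=
  [/\ c != [::], cycle (fun d d' => dart_tgt d == dart_src d') c,
      uniq (map (@dart_src R Q) c) & uniq (map fst c)].

(* Connectedness of the graph is part of [network]. *)
Definition is_tree (R : realType) (Q : network R) : Prop :=
  forall c : seq (net_arc Q * bool), ~ is_cycle c.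

Definition lambda (R : realType) (Q : network R) (A : set Q) : R :=
  fine (length_measure A).

Definition components (T : topologicalType) (A : set T) : set (set T) :=
  connected_component A @` A.

Definition max_comp (R : realType) (Q : network R) (x : Q) : R :=
  sup (@lambda R Q @` components (~` [set x])).

Definition is_centroid (R : realType) (Q : network R) (x : Q) : Prop :=
  forall y : Q, max_comp x <= max_comp y.

(* [C] enumerates without repetition the connected components of the
   complement of [x], by nonincreasing length. *)
Definition is_comp_enum (R : realType) (Q : network R) (x : Q) (n : nat)
    (C : 'I_n -> set Q) : Prop :=
  [/\ injective C, range C = components (~` [set x])
    & forall i j : 'I_n, (i <= j)%N -> lambda (C j) <= lambda (C i)].

Section game.
Context (R : realType) (Q : network R).

(* Payoff to the attacker choosing [S] when the booby trap is at [y]. *)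
Definition payoff (S : set Q) (y : Q) : R := if y \in S then 0 else lambda S.

(* Expected payoff when the location of the booby trap has law [sigma]. *)
Definition defender_payoff (sigma : {measure set Q -> \bar R})
    (S : set Q) : R :=
  \int[sigma]_y payoff S y.

(* Expected payoff when the attacker uses a mixed strategy with finite support,
   given as a list of pairs (probability, set). *)
Definition attacker_payoff (tau : seq (R * set Q)) (y : Q) : R :=
  \sum_(w <- tau) w.1 * payoff w.2 y.

Lemma max_comp_ge0 (x : Q) : 0 <= max_comp x.
Proof.
rewrite /max_comp; set E := (X in sup X).
have [[[r Er] Eb]|/sup_out ->//] := pselect (has_sup E).
apply: le_trans (ub_le_sup Eb Er).
by case: Er => A _ <-; rewrite fine_ge0// measure_ge0.
Qed.

Definition centroid_uniform_prob (x : Q) : R :=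
  4 * max_comp x / (1 + 4 * max_comp x ^+ 2).

Definition centroid_point_prob (x : Q) : R :=
  (1 - 2 * max_comp x) ^+ 2 / (1 + 4 * max_comp x ^+ 2).

Lemma centroid_uniform_prob_ge0 (x : Q) : 0 <= centroid_uniform_prob x.
Proof.
have h0 := max_comp_ge0 x; apply: divr_ge0; first exact: mulr_ge0.
by rewrite addr_ge0// mulr_ge0// sqr_ge0.
Qed.

Lemma centroid_point_prob_ge0 (x : Q) : 0 <= centroid_point_prob x.
Proof. apply: divr_ge0; first exact: sqr_ge0.
by rewrite addr_ge0// mulr_ge0// sqr_ge0. Qed.

Definition centroid_strategy (x : Q) : {measure set Q -> \bar R} :=
  measure_add (mscale (NngNum (centroid_uniform_prob_ge0 x))
                     (@length_measure R Q))
              (mscale (NngNum (centroid_point_prob_ge0 x)) (dirac x)).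

End game.

Section partition.
Context (R : realType) (Q : network R) (n : nat).

Definition part_D (a : 'I_n -> R) (S : {set 'I_n}) : R :=
  \sum_(j | j \notin S) (a j)^-1 + (\sum_(j in S) a j)^-1.

Definition part_W (a : 'I_n -> R) (S : {set 'I_n}) : R :=
  (n - #|S|)%N%:R / part_D a S.

Definition is_best_part (a : 'I_n -> R) (S : {set 'I_n}) : Prop :=
  S != finset.set0 /\
  forall T : {set 'I_n}, T != finset.set0 -> part_W a T <= part_W a S.

Definition partition_strategy (x : Q) (C : 'I_n -> set Q) (S : {set 'I_n}) :
    seq (R * set Q) :=
  let a i := lambda (C i) in
  ((\sum_(j in S) a j)^-1 / part_D a S,
   [set x] `|` \bigcup_(j in [set j | j \in S]) C j)
  :: [seq ((a i)^-1 / part_D a S, C i) | i <- enum (finset.setC S)].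

End partition.

(* Main.v *)
(* Deleting an arc [e] of a tree separates its ends, so the parametrization of
   [e] has a 1-Lipschitz left inverse [arc_coord e : Q -> R] whose fibres over
   [0, len e] are single points.  Hence a component of the complement of [x] is
   entered from [x] along a single arc, and stepping into a component of length
   [> 1/2] decreases [max_comp]; the centroid therefore has [a = max_comp x <=
   1/2].  Against the centroid strategy a connected set containing [x] earns at
   most [p l (1 - l) <= p / 4], and one avoiding [x], whose length is at most
   [a], at most the value at length [a], which is again
   [p / 4 = a / (1 + 4a^2)].
   The partition strategy earns exactly [W(S)] everywhere, and merging all the
   components but the largest gives [W(S) >= a (1 - a)].  Finally
   [27 (1 - a) (1 + 4a^2) - 25 = 108 (a - 1/6)^2 (2/3 - a) >= 0]. *)

Require Import Defs.
From mathcomp Require Import all_boot all_order all_algebra.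
From mathcomp Require Import all_classical all_reals all_analysis.
From mathcomp Require Import measurable_realfun ring lra.

Set Implicit Arguments.
Unset Strict Implicit.
Unset Printing Implicit Defensive.

Import Order.TTheory GRing.Theory Num.Theory.
Import numFieldNormedType.Exports HBNNSimple.

Local Open Scope classical_set_scope.
Local Open Scope ring_scope.

(** * Metric neighbourhoods, and arcs of a tree as bridges *)

Lemma net_nbhsP (R : realType) (Q : network R) (z : Q) (P : set Q) :
  nbhs z P <-> exists2 r : R, 0 < r & forall w, net_dist z w < r -> P w.
Proof.
split=> [/(nbhs_ballP (z : (Q : pseudoMetricType R)))[r r0 rP]|[r r0 rP]].
  by exists r => // w zw; apply: rP; rewrite ballEmdist.
by apply/(nbhs_ballP (z : (Q : pseudoMetricType R))); exists r.
Qed.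

Definition adjacent_off (R : realType) (Q : network R) (e : net_arc Q) :
    rel (node Q) :=
  [rel u v | [exists e', (e' != e) && (((src e' == u) && (tgt e' == v))
                                    || ((src e' == v) && (tgt e' == u)))]].

Lemma adjacent_off_sym (R : realType) (Q : network R) (e : net_arc Q) :
  symmetric (adjacent_off e).
Proof. by move=> u v; apply: eq_existsb => e'; rewrite orbC. Qed.

(* The last clause strengthens the induction: an arc at a node that the path
   never revisits cannot occur again. *)
Lemma dart_path (R : realType) (Q : network R) (e : net_arc Q) (u : node Q)
    (p : seq (node Q)) :
  path (adjacent_off e) u p -> uniq (u :: p) ->
  exists c : seq (net_arc Q * bool),
    [/\ forall d0, dart_tgt d0 = u ->
          path (fun d d' => dart_tgt d == dart_src d') d0 c
          /\ dart_tgt (last d0 c) = last u p,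
        map (@dart_src R Q) c = belast u p,
        uniq (map fst c)
      & forall d, d \in c ->
          [/\ d.1 != e, dart_src d \in u :: p & dart_tgt d \in u :: p]].
Proof.
elim: p u => [u _ _|w p IH u /= /andP[/existsP[e' /andP[e'e Hu]] pw]].
  by exists [::]; split.
move=> /andP[uNw uw]; have [c [cpath csrc cuniq cmem]] := IH w pw uw.
pose d : net_arc Q * bool := (e', src e' == u).
have [ds dt] : dart_src d = u /\ dart_tgt d = w.
  (* If [src e'] is [u], reading the arc backwards would force [w = u], which [uNw] excludes. *)
  rewrite /dart_src /dart_tgt /d /=; case: ifPn => [/eqP su|su].
    split=> //; case/orP: Hu => /andP[/eqP sE /eqP tE] //.
    by move: uNw; rewrite inE -su sE eqxx.
  by move: Hu; rewrite (negbTE su) /= => /andP[/eqP -> /eqP ->].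
have dNc : e' \notin map fst c.
  apply/negP => /mapP[d' /cmem[_ d's d't] e'E].
  suff : u \in w :: p by rewrite (negbTE uNw).
  move: ds d's d't; rewrite /d /dart_src /dart_tgt -e'E /=.
  by case: ifP => _ <-; case: ifP.
exists (d :: c); split.
- move=> d0 d0u /=; have [-> ->] := cpath d dt.
  by rewrite ds d0u eqxx.
- by rewrite /= ds csrc.
- by rewrite /= dNc.
- move=> d'; rewrite inE => /predU1P[->|/cmem[-> s t]].
    by rewrite ds dt !inE !eqxx ?orbT.
  by rewrite inE s orbT inE t orbT.
Qed.

(** A simple path from [tgt e] to [src e] off [e], closed up by the dart [(e, true)], would be a
    cycle. *)
Lemma tree_arc_bridge (R : realType) (Q : network R) (e : net_arc Q) :
  is_tree Q -> ~~ connect (adjacent_off e) (tgt e) (src e).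
Proof.
move=> treeQ; apply/negP => /connectP[p0 pp0].
case/shortenP: pp0 => p pp up _ sE.
have [c [cpath csrc cuniq cmem]] := dart_path pp up.
have [cp cl] := cpath (e, true) erefl.
apply: (treeQ ((e, true) :: c)); split=> //.
- by rewrite /= rcons_path cp /= cl -sE.
- by move: up; rewrite lastI -sE rcons_uniq /= csrc.
- rewrite /= cuniq andbT; apply/negP => /mapP[d /cmem[+ _ _] eE].
  by rewrite -eE eqxx.
Qed.

(** * A coordinate function along one arc *)

Section arc_coordinate.
Context (R : realType) (Q : network R) (e : net_arc Q).
Hypothesis treeQ : is_tree Q.

Let far (v : node Q) := connect (adjacent_off e) (tgt e) v.

Let far_arc (e' : net_arc Q) : e' != e -> far (src e') = far (tgt e').
Proof.
move=> e'e; apply: (same_connect1r (sym_connect_sym (@adjacent_off_sym R Q e))).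
by apply/existsP; exists e'; rewrite e'e !eqxx.
Qed.

(** Signed distances past the two ends extend the parameter of [e] to all of [Q]. Every other arc
    has both ends on the same side, so one formula serves along it; the bridge property makes the
    formulas agree with the parameter at the ends of [e]. *)
Definition arc_coord (z : Q) : R :=
  let beyond := len e + net_dist z (Node (tgt e)) in
  let before := - net_dist z (Node (src e)) in
  match z with
  | Node v => if far v then beyond else before
  | @Inner _ _ e' t =>
      if e' == e then val t else if far (src e') then beyond else before
  end.

Lemma arc_coordK t : 0 <= t <= len e -> arc_coord (arc_pt e t) = t.
Proof.
move=> /andP[t0 tl]; rewrite /arc_pt; case: insubP => [u _ <-/=|].
  by rewrite eqxx.
rewrite negb_and -!leNgt => tb; rewrite /arc_coord.
have farT : far (tgt e) by exact: connect0.
have farS : far (src e) = false by exact/negbTE/tree_arc_bridge.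
case: (leP t 0) tb => /= [t0' _|_ tb].
  by rewrite farS net_distxx; apply/le_anti; lra.
by rewrite farT net_distxx; apply/le_anti; lra.
Qed.

Lemma arc_coord_off e' t : e' != e -> 0 <= t <= len e' ->
  arc_coord (arc_pt e' t) =
    if far (src e') then len e + net_dist (arc_pt e' t) (Node (tgt e))
    else - net_dist (arc_pt e' t) (Node (src e)).
Proof.
move=> e'e /andP[t0 tl]; rewrite /arc_pt; case: insubP => [u _ _/=|_].
  by rewrite (negbTE e'e).
by rewrite /arc_coord; case: (leP t 0) => // _; rewrite (far_arc e'e).
Qed.

(** By [net_dist_lipschitz] only single closed arcs matter: on [e] the map returns the parameter,
    elsewhere it is a distance to a fixed node up to sign and constant. *)
Lemma arc_coord_lipschitz x y :
  `|arc_coord x - arc_coord y| <= net_dist x y.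
Proof.
apply: net_dist_lipschitz => e' a b ha hb.
have [ee|e'e] := eqVneq e' e; first by subst e'; rewrite !arc_coordK// distrC.
rewrite !arc_coord_off//; apply: le_trans (net_dist_arc e' a b).
move: (arc_pt e' a) (arc_pt e' b) => z w; case: ifP => _;
  [move: (Node _) => s|move: (Node _) => s]; rewrite ler_norml;
  have := net_dist_triangle w z s; have := net_dist_triangle z w s;
  rewrite (net_dist_sym w z); lra.
Qed.

Lemma arc_coord_continuous : continuous (arc_coord : Q -> R).
Proof.
move=> z A /nbhs_ballP[r r0 rA]; apply/net_nbhsP; exists r => // w zw.
by apply: rA; apply: le_lt_trans zw; exact: arc_coord_lipschitz.
Qed.

(** Off the open arc the value is [len e + d] or [- d], with [d] the distance to an end; it falls in
    [[0, len e]] only when [d = 0], and then the point is that end. *)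
Lemma arc_coord_inv z t : 0 <= t <= len e -> arc_coord z = t ->
  z = arc_pt e t.
Proof.
move=> /andP[t0 tl] zt; have le0 := len_gt0 e.
have beyond : t = len e + net_dist z (Node (tgt e)) -> z = arc_pt e t.
  move=> tE; have d0 := net_dist_ge0 z (Node (tgt e)).
  have /net_dist_eq0 -> : net_dist z (Node (tgt e)) = 0 by apply/le_anti; lra.
  by rewrite arc_pt_ge// tE lerDl.
have before : t = - net_dist z (Node (src e)) -> z = arc_pt e t.
  move=> tE; have d0 := net_dist_ge0 z (Node (src e)).
  have /net_dist_eq0 -> : net_dist z (Node (src e)) = 0 by apply/le_anti; lra.
  by rewrite arc_pt_le0// tE oppr_le0.
case: z zt beyond before => [v|e' u] /=; first by case: ifP => _ <- A B; auto.
case: eqP => [ee|_]; first by subst e' => <- _ _; rewrite arc_pt_inner.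
by case: ifP => _ <- A B; auto.
Qed.

Lemma arc_coord_off_out e' t : e' != e -> 0 <= t <= len e' ->
  arc_coord (arc_pt e' t) <= 0 \/ len e <= arc_coord (arc_pt e' t).
Proof.
move=> e'e ht; rewrite arc_coord_off//; case: ifP => _; [right|left].
  by rewrite lerDl net_dist_ge0.
by rewrite oppr_le0 net_dist_ge0.
Qed.

End arc_coordinate.

Lemma net_open_measurable (R : realType) (Q : network R) (U : set Q) :
  open U -> measurable U.
Proof. exact: sub_sigma_algebra. Qed.

(** * Connected components in a topological space *)

Section components.
Context (T : topologicalType).
Implicit Types A B E F : set T.

Lemma components_sub A E : components A E -> E `<=` A.
Proof. by move=> [z _ <-]; exact: connected_component_sub. Qed.

Lemma components_connected A E : components A E -> connected E.
Proof. by move=> [z _ <-]; exact: component_connected. Qed.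

Lemma components_nonempty A E : components A E -> E !=set0.
Proof. by move=> [z Az <-]; exists z; exact: connected_component_refl. Qed.

Lemma components_max A E B : components A E -> connected B -> B `<=` A ->
  E `&` B !=set0 -> B `<=` E.
Proof.
move=> [z _ <-] cB BA [w [zw Bw]].
by rewrite (same_connected_component zw); exact: connected_component_max.
Qed.

Lemma components_disjoint A E F : components A E -> components A F ->
  E `&` F !=set0 -> E = F.
Proof.
move=> AE AF EF; apply/seteqP; split.
  apply: (components_max AF (components_connected AE) (components_sub AE)).
  by rewrite setIC.
exact: (components_max AE (components_connected AF) (components_sub AF)).
Qed.

Lemma components_cover A : \bigcup_(E in components A) E = A.
Proof.
apply/seteqP; split=> [z [E AE Ez]|z Az]; first exact: components_sub AE _ Ez.
exists (connected_component A z); first by exists z.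
exact: connected_component_refl.
Qed.

End components.

(** * Paths, and components of the complement of a point *)

Section net_connected.
Context (R : realType) (Q : network R).
Implicit Types (x y z : Q) (e : net_arc Q) (E : set Q).

Lemma arc_image_connected e (I : set R) : is_interval I ->
  connected (arc_pt e @` I : set Q).
Proof.
move=> /connected_intervalP cI; apply: connected_continuous_connected => //.
by apply: continuous_subspaceT => t; exact: arc_pt_continuous.
Qed.

(** The union of the traced segments serves as [K]. The distance bound shows that a path too short
    to reach a given point misses it. *)
Lemma path_connected_set x y c : is_path x y c ->
  exists K : set Q, [/\ connected K, K x, K y
    & forall z, K z -> net_dist x z <= path_length c].
Proof.
elim: c x => [x /= ->|[[e a] b] c IH x /= [ha hb <- hc]].
  exists [set y]; split=> //; first exact: connected1.
  by move=> z ->; rewrite net_distxx path_length_ge0.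
have [K [cK Kb Ky Kd]] := IH _ hc.
pose I : set R := `[Num.min a b, Num.max a b]%classic.
have Ia : I a by rewrite /I /= in_itv /= ge_min le_max lexx.
have Ib : I b by rewrite /I /= in_itv /= ge_min le_max !lexx !orbT.
exists ((arc_pt e @` I) `|` K); split; [|by left; exists a|by right|].
- apply: connectedU cK; last exact/arc_image_connected/interval_is_interval.
  by exists (arc_pt e b); split=> //; exists b.
rewrite /path_length big_cons /= -/(path_length c).
move=> z [[t It <-]|Kz].
  rewrite (le_trans (net_dist_arc e a t))// ler_wpDr ?path_length_ge0//.
  move: It; rewrite /I /= in_itv /= => /andP[].
  have := ler_norm (b - a); have := ler_norm (a - b); rewrite (distrC a b).
  by rewrite ler_norml; case: (leP a b); lra.
rewrite (le_trans (net_dist_triangle (arc_pt e b) _ _))// lerD ?Kd//.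
exact: net_dist_arc.
Qed.

(** Points closer to [z] than [x] is are joined to [z] by paths too short to reach [x]. *)
Lemma component_open x E : components (~` [set x]) E -> open E.
Proof.
move=> cE; rewrite openE => z Ez; apply/net_nbhsP.
have zx : z <> x by have := components_sub cE Ez.
have zx0 : 0 < net_dist z x.
  by rewrite lt_neqAle net_dist_ge0 andbT eq_sym; apply/eqP => /net_dist_eq0.
exists (net_dist z x) => // w; rewrite ltNge => zw.
have [c hc cw] : exists2 c, is_path z w c & path_length c < net_dist z x.
  apply: contrapT => H; move/negP: zw; apply; apply: net_dist_ge => c hc.
  by rewrite leNgt; apply/negP => cw; apply: H; exists c.
have [K [cK Kz Kw Kd]] := path_connected_set hc.
apply: (components_max cE cK) Kw; last by exists z.
by move=> v Kv /= vx; have := Kd v Kv; rewrite vx leNgt cw.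
Qed.

Lemma component_measurable x E : components (~` [set x]) E -> measurable E.
Proof. by move=> /component_open/net_open_measurable. Qed.

(** On a path from a point of [E] to [x], segments that miss [x] stay in [E]; the first one that
    meets [x] gives the arc. *)
Lemma component_meets_arc x E : components (~` [set x]) E ->
  exists e a t, [/\ 0 <= a <= len e, 0 <= t <= len e, arc_pt e t = x
                  & E (arc_pt e a)].
Proof.
move=> cE; have [z Ez] := components_nonempty cE.
have [c] := path_exists z x; elim: c z Ez => [z Ez /= zx|].
  by have /(_ zx) := components_sub cE Ez.
move=> [[e a] b] c IH z Ez /= [ha hb az hc].
pose I : set R := `[Num.min a b, Num.max a b]%classic.
have Ia : I a by rewrite /I /= in_itv /= ge_min le_max lexx.
have Ib : I b by rewrite /I /= in_itv /= ge_min le_max !lexx !orbT.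
have [[t It tx]|Nt] := pselect (exists2 t, I t & arc_pt e t = x).
  exists e, a, t; split=> //; last by rewrite az.
  by move: It; rewrite /I /= in_itv /=; case: (leP a b); lra.
apply: IH hc; apply: (components_max cE (B := arc_pt e @` I)).
- exact/arc_image_connected/interval_is_interval.
- by move=> _ [t It <-] tx; apply: Nt; exists t.
- by exists z; split=> //; exists a.
- by exists b.
Qed.

End net_connected.

(** * Lengths in a tree, and the germ of a component at a point *)

Section tree_length.
Context (R : realType) (Q : network R).
Hypothesis treeQ : is_tree Q.
Implicit Types (x y z : Q) (e : net_arc Q) (E : set Q).

Lemma length_measure_set1 x : length_measure [set x] = 0%E.
Proof.
rewrite /length_measure big1// => e _; rewrite /arc_length.
(* [arc_coord e] inverts the parametrization, so the arc passes through [x] at most once. *)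
have : `]0, len e[%classic `&` arc_pt e @^-1` [set x] `<=` [set arc_coord e x].
  move=> t [/=]; rewrite in_itv /= => /andP[t0 tl] tx.
  by rewrite -tx arc_coordK// !ltW.
by move=> /subset_set1[->|->]; rewrite ?measure0// lebesgue_measure_set1.
Qed.

(** Only [e] contributes: on the other arcs the coordinate stays outside []0, len e[]. *)
Lemma length_arc_coord e lo hi : 0 <= lo -> lo <= hi -> hi <= len e ->
  length_measure (arc_coord e @^-1` `]lo, hi[%classic) = (hi - lo)%:E.
Proof.
move=> lo0 lohi hil; rewrite /length_measure (bigD1 e)//= big1 ?adde0.
  rewrite /arc_length (_ : _ `&` _ = `]lo, hi[%classic).
    rewrite lebesgue_measure_itv /= lte_fin; case: ltgtP lohi => // -> _.
    by rewrite subrr.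
  apply/seteqP; split=> t /=; rewrite !in_itv /=.
    by move=> [t0]; rewrite arc_coordK//; lra.
  by move=> tI; split; [|rewrite arc_coordK//]; lra.
move=> e' e'e; rewrite /arc_length (_ : _ `&` _ = set0) ?measure0//.
apply/seteqP; split=> // t [/=]; rewrite !in_itv /= => t0.
have := @arc_coord_off_out R Q e e' t e'e.
by case; [lra|move=> ?; lra|move=> ?; lra].
Qed.

(* In a tree a component of the complement of [x] is entered from [x] through
   an initial segment of one arc, and [G] is the signed distance from [x] along
   that arc. *)
Lemma component_germ x E : components (~` [set x]) E ->
  exists2 eps0 : R, 0 < eps0 & forall eps, 0 < eps < eps0 ->
    exists (G : Q -> R) (y : Q),
      [/\ continuous G, G @^-1` [set 0] = [set x], G @^-1` [set eps] = [set y],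
          G @^-1` `]0, eps[%classic `<=` E
        & length_measure (G @^-1` `]0, eps[%classic) = eps%:E].
Proof.
move=> cE; have [e [a [t [ha ht tx Ea]]]] := component_meets_arc cE.
have at' : a != t.
  by apply/eqP => ta; have := components_sub cE Ea; apply; rewrite ta.
(* [s] is the direction of [e] from [x] towards the chosen point of [E], and [s * (a - t)] is the
   length of arc between them. *)
pose s : R := if t < a then 1 else -1.
have s1 : s = 1 \/ s = -1 by rewrite /s; case: ifP; [left|right].
have sa : 0 < s * (a - t).
  rewrite /s; case: (ltP t a) => [|ta]; first lra.
  by have : a < t; [rewrite lt_neqAle at' | lra].
exists (s * (a - t)) => // eps /andP[eps0 epsa].
have hs : 0 <= t + s * eps <= len e by case: s1 sa epsa => ->; lra.
exists (fun z => s * (arc_coord e z - t)), (arc_pt e (t + s * eps)).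
have GE z r : 0 <= t + s * r <= len e ->
    s * (arc_coord e z - t) = r -> z = arc_pt e (t + s * r).
  move=> hr zr; apply: arc_coord_inv => //.
  by case: s1 zr => ->; lra.
split.
- move=> z; apply: (@continuous_comp _ _ _ (arc_coord e)
    (fun r => s * (r - t))); first exact: arc_coord_continuous.
  by apply: cvgM; [exact: cvg_cst|apply: cvgB; [exact: cvg_id|exact: cvg_cst]].
- apply/seteqP; split=> z /=.
    by move=> /GE; rewrite mulr0 addr0 tx => /(_ ht).
  by move=> ->; rewrite -tx arc_coordK// subrr mulr0.
- apply/seteqP; split=> z /=; first exact: GE.
  by move=> ->; rewrite arc_coordK//; case: s1 => ->; lra.
(* [I] parametrizes the segment from [x], excluded, to the chosen point of [E]: its image is
   connected, misses [x] and meets [E], so it lies in [E]. *)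
- pose I : set R := [set r | 0 < s * (r - t) <= s * (a - t)].
  have EI : arc_pt e @` I `<=` E.
    apply: (components_max cE).
    + apply: arc_image_connected => u v /= Iu Iv w; rewrite /I /= in Iu Iv *.
      by case: s1 Iu Iv => ->; lra.
    + move=> _ [u Iu <-] /= ux; rewrite /I /= in Iu.
      suff ut : u = t by move: Iu; rewrite ut; lra.
      rewrite -[LHS](@arc_coordK R Q e treeQ).
        by rewrite ux -tx arc_coordK.
      by case: s1 Iu => ->; lra.
    + by exists (arc_pt e a); split=> //; exists a => //; rewrite /I /= sa lexx.
  move=> z /=; rewrite in_itv /= => zI; apply: EI; exists (arc_coord e z).
    by rewrite /I /=; lra.
  apply/esym/arc_coord_inv => //.
  by case: s1 sa epsa zI => ->; lra.
- case: s1 sa epsa hs => -> sa epsa hs.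
    rewrite [in RHS](_ : eps = (t + eps) - t); last lra.
    rewrite -(@length_arc_coord e); [|lra..]; congr length_measure.
    by apply/seteqP; split=> z /=; rewrite !in_itv /=; lra.
  rewrite [in RHS](_ : eps = t - (t - eps)); last lra.
  rewrite -(@length_arc_coord e); [|lra..]; congr length_measure.
  by apply/seteqP; split=> z /=; rewrite !in_itv /=; lra.
Qed.

End tree_length.

(** * Length as a real-valued set function when the total is 1 *)

Lemma le_length_measure (R : realType) (Q : network R) (A B : set Q) :
  A `<=` B -> (length_measure A <= length_measure B)%E.
Proof.
move=> AB; apply: lee_sum => e _; rewrite /arc_length.
by apply: le_mu_ext => t [? ?]; split=> //; exact: AB.
Qed.

Section unit_length.
Context (R : realType) (Q : network R).
Hypothesis total1 : length_measure [set: Q] = 1%E.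
Implicit Types (A B E : set Q) (x : Q).

Lemma lambdaE A : length_measure A = (lambda A)%:E.
Proof.
rewrite /lambda fineK// ge0_fin_numE ?measure_ge0//.
by rewrite (le_lt_trans (le_length_measure (@subsetT _ A)))// total1 ltry.
Qed.

Lemma lambda_ge0 A : 0 <= lambda A.
Proof. by rewrite -lee_fin -lambdaE measure_ge0. Qed.

(** The Lebesgue measure is here an outer measure, monotone on all sets, so arbitrary connected sets
    can be compared. *)
Lemma le_lambda A B : A `<=` B -> lambda A <= lambda B.
Proof. by move=> /le_length_measure; rewrite !lambdaE lee_fin. Qed.

Lemma lambda_le1 A : lambda A <= 1.
Proof. by rewrite -lee_fin -lambdaE -total1 le_length_measure. Qed.

Lemma lambdaU A B : measurable A -> measurable B -> A `&` B = set0 ->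
  lambda (A `|` B) = lambda A + lambda B.
Proof.
move=> mA mB AB; apply: EFin_inj; rewrite EFinD -!lambdaE.
exact: measureU.
Qed.

Lemma lambdaC A : measurable A -> lambda (~` A) = 1 - lambda A.
Proof.
move=> mA; have := lambdaU mA (measurableC mA) (setICr A).
rewrite setUCr {1}/lambda total1 /=; lra.
Qed.

Lemma max_comp_ge x E : components (~` [set x]) E -> lambda E <= max_comp x.
Proof.
move=> cE; apply: ub_le_sup; last by exists E.
by exists 1 => _ [F _ <-]; exact: lambda_le1.
Qed.

(** If nonempty, [A] lies in a single component of the complement of [x]. *)
Lemma connected_lambda_le x A : connected A -> ~ A x -> lambda A <= max_comp x.
Proof.
move=> cA Ax; have [->|/set0P[z Az]] := eqVneq A set0.
  by rewrite /lambda measure0 max_comp_ge0.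
have Ac : A `<=` ~` [set x] by move=> v Av vx; apply: Ax; rewrite -vx.
have cz : components (~` [set x]) (connected_component (~` [set x]) z).
  by exists z => //; exact: Ac.
apply: le_trans (max_comp_ge cz); apply: le_lambda.
exact: connected_component_max.
Qed.

End unit_length.

(** * The centroid leaves no component longer than one half *)

(** Intermediate values: the image of [A] is an interval that avoids [c]. *)
Lemma connected_side_gt (R : realType) (T : topologicalType) (G : T -> R)
    (A : set T) (c : R) (z w : T) : continuous G -> connected A ->
  (forall v, A v -> G v <> c) -> A z -> A w -> c < G z -> c < G w.
Proof.
move=> cG cA Ac Az Aw cz; rewrite ltNge; apply/negP => wc.
have /connected_intervalP GA : connected (G @` A).
  by apply: connected_continuous_connected => //; exact: continuous_subspaceT.
suff [v Av vc] : (G @` A) c by exact: Ac vc.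
by apply: (GA (G w) (G z)); [exists w|exists z|rewrite wc ltW].
Qed.

Lemma connected_side_lt (R : realType) (T : topologicalType) (G : T -> R)
    (A : set T) (c : R) (z w : T) : continuous G -> connected A ->
  (forall v, A v -> G v <> c) -> A z -> A w -> G z < c -> G w < c.
Proof.
move=> cG cA Ac Az Aw cz; have := Ac w Aw.
case: (ltgtP (G w) c) => // cw _.
by have := connected_side_gt cG cA Ac Aw Az cw; rewrite ltNge ltW.
Qed.

(* If a component [E] of the complement of [x] had more than half of the
   length, moving [x] slightly into [E] would decrease [max_comp]. *)
Lemma centroid_component_le_half (R : realType) (Q : network R) (x : Q)
    (E : set Q) :
  is_tree Q -> length_measure [set: Q] = 1%E -> is_centroid x ->
  components (~` [set x]) E -> lambda E <= 1 / 2.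
Proof.
move=> treeQ total1 cx cE; rewrite leNgt; apply/negP => E2.
have [eps0 eps00 H] := component_germ treeQ cE.
(* [eps < eps0] provides the germ, and [eps < 2 * lambda E - 1] makes [1 - lambda E + eps] smaller
   than [lambda E]; halving makes both strict. *)
pose eps := Num.min eps0 (2 * lambda E - 1) / 2.
have epsE : 0 < eps /\ eps < eps0 /\ eps < 2 * lambda E - 1.
  by rewrite /eps; case: (leP eps0 (2 * lambda E - 1)); lra.
have [eps_gt0 [eps_lt eps_lt2]] := epsE.
have [|G [y [cG G0 Geps PE Plen]]] := H eps; first by rewrite eps_gt0.
set P := G @^-1` _ in PE Plen.
have lP : lambda P = eps by rewrite /lambda Plen.
have oP : open P.
  by apply: open_comp; [move=> z _; exact: cG|exact: interval_open].
have mP := net_open_measurable oP.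
have mE := component_measurable cE.
have Gx : G x = 0 by have : [set x] x by []; rewrite -G0.
have Gy : G y = eps by have : [set y] y by []; rewrite -Geps.
have [z0 Pz0] : P !=set0.
  apply/set0P/negP => /eqP P0; move: eps_gt0.
  by rewrite -lP P0 /lambda measure0 ltxx.
have Epos z : E z -> 0 < G z.
  move=> Ez; apply: (connected_side_gt cG (components_connected cE)) Ez _.
  - move=> v Ev Gv; apply: (components_sub cE Ev).
    by rewrite -G0.
  - exact: PE Pz0.
  - by move: Pz0; rewrite /P /= in_itv /= => /andP[].
(* A component of the complement of [y] lies where [G < eps], hence in the union of [~]
   E[and]P[, or where]G > eps[, hence in]E[minus]P[or in]~[E]; [m] bounds all these lengths. *)
pose m := Num.max (lambda E - eps) (1 - lambda E + eps).
have mE' : m < lambda E by rewrite /m gt_max; lra.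
have m1 : lambda E - eps <= m by rewrite /m le_max lexx.
have m2 : 1 - lambda E + eps <= m by rewrite /m le_max lexx orbT.
suff : max_comp y <= m.
  have := cx y; have := max_comp_ge total1 cE; lra.
apply: ge_sup.
  exists (lambda (connected_component (~` [set y]) x)).
  exists (connected_component (~` [set y]) x) => //; exists x => //= xy.
  by move: Gx; rewrite xy Gy; lra.
move=> _ [F cF <-].
have [w Fw] := components_nonempty cF.
have mF := component_measurable cF.
have Feps v : F v -> G v <> eps.
  move=> Fv Gv; apply: (components_sub cF Fv).
  by rewrite -Geps.
have cGF := components_connected cF.
case: (ltgtP (G w) eps) => [weps|weps|]; last by move=> /(Feps _ Fw).
  have FE : F `<=` (~` E) `|` P.
    move=> v Fv; have [Ev|Ev] := pselect (E v); [right|by left].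
    rewrite /P /= in_itv /= Epos//=.
    exact: connected_side_lt cG cGF Feps Fw Fv weps.
  apply: le_trans m2; rewrite -lP -(lambdaC total1 mE) -lee_fin EFinD.
  rewrite -!(lambdaE total1); apply: le_trans (le_length_measure FE) _.
  by apply: measureU2 => //; exact: measurableC.
have Fgt v : F v -> eps < G v.
  by move=> Fv; exact: connected_side_gt cG cGF Feps Fw Fv weps.
have Fx : F `<=` ~` [set x].
  by move=> v /Fgt + vx; rewrite vx Gx; lra.
(* On this side [F] also avoids [x], so it is either contained in [E] or disjoint from it. *)
have [EF|EF] := pselect (E `&` F !=set0).
  have FE := components_max cE cGF Fx EF.
  have FP : F `&` P = set0.
    apply/seteqP; split=> // v [/Fgt + ]; rewrite /P /= in_itv /=; lra.
  apply: le_trans m1; rewrite lerBrDr -lP -lambdaU//; apply: le_lambda => //.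
  by move=> v [/FE|/PE].
apply: le_trans (_ : 1 - lambda E <= m); last lra.
rewrite -lambdaC//; apply: le_lambda => // v Fv Ev.
by apply: EF; exists v.
Qed.

(** * Payoffs against the centroid strategy *)

(* [A] is not assumed measurable: the integral of a nonnegative function is the
   supremum of the integrals of the simple functions below it. *)
Lemma integral_off_le d (T : measurableType d) (R : realType)
    (mu : {measure set T -> \bar R}) (A : set T) (l : R) (K : \bar R) :
  0 <= l ->
  (forall B, measurable B -> A `&` B = set0 -> (l%:E * mu B <= K)%E) ->
  (\int[mu]_y (if y \in A then 0 else l)%:E <= K)%E.
Proof.
move=> l0 HB; rewrite ge0_integralTE; last by move=> y; case: ifP.
apply: ge_ereal_sup => _ [h /= hl <-].
(* The support of [h] is disjoint from [A], where [h] is at most 0, and [h] is at most [l] on it. *)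
pose B := ~` (h @^-1` [set 0]).
have mB : measurable B by apply: measurableC; exact: measurable_sfunP.
apply: le_trans (HB B mB _); last first.
  apply/seteqP; split=> // y [Ay]; apply; apply/le_anti.
  by have := hl y; rewrite mem_set//= !lee_fin => ->; rewrite fun_ge0.
rewrite -integralT_nnsfun -[mu B](congr1 mu (setIT B)) -integral_indic//.
rewrite -ge0_integralZl_EFin//; last first.
  by apply/measurable_EFinP; exact: measurable_indic.
apply: ge0_le_integral => //.
- by move=> y _; rewrite lee_fin fun_ge0.
- by apply/measurable_EFinP.
- apply: measurable_funeM; apply/measurable_EFinP; exact: measurable_indic.
move=> y _; rewrite indicE; have [By|By] := pselect (B y).
  rewrite (mem_set By) mule1; apply: le_trans (hl y) _.
  by case: ifP; rewrite lee_fin.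
rewrite memNset// mule0.
by move/contrapT: By => /= ->.
Qed.

Lemma defender_payoff_le (R : realType) (Q : network R) (x : Q) (A : set Q) :
  length_measure [set: Q] = 1%E -> max_comp x <= 1 / 2 -> connected A ->
  defender_payoff (centroid_strategy x) A
    <= max_comp x / (1 + 4 * max_comp x ^+ 2).
Proof.
move=> total1 a2 cA; have a0 := max_comp_ge0 x.
set a := max_comp x in a0 a2 *.
have d0 : 0 < 1 + 4 * a ^+ 2 by nra.
set K := a / _; have K0 : 0 <= K by rewrite divr_ge0// ltW.
suff IK : (\int[centroid_strategy x]_y (payoff A y)%:E <= K%:E)%E.
  rewrite /defender_payoff /Rintegral; move: IK.
  have : (0 <= \int[centroid_strategy x]_y (payoff A y)%:E)%E.
    apply: integral_ge0 => y _; rewrite lee_fin /payoff.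
    by case: ifP => // _; exact: lambda_ge0.
  by case: (integral _ _ _) => [r||]//=; rewrite !lee_fin.
have lA0 := lambda_ge0 total1 A.
(* It remains to bound [lambda A] times the mass of any measurable [B] disjoint from [A]. *)
apply: integral_off_le => // B mB AB.
have lAB : lambda A <= 1 - lambda B.
  rewrite -lambdaC//; apply: le_lambda => // y Ay By.
  by have : (A `&` B) y by []; rewrite AB.
have lB0 := lambda_ge0 total1 B.
rewrite [centroid_strategy x B]measure_addE /= /mscale /=.
rewrite lambdaE// diracE -!EFinM lee_fin.
rewrite /centroid_uniform_prob /centroid_point_prob -/a /K.
rewrite -(ler_pM2r d0) divfK ?gt_eqF//.
have -> : lambda A * (4 * a / (1 + 4 * a ^+ 2) * lambda B
    + (1 - 2 * a) ^+ 2 / (1 + 4 * a ^+ 2) * (x \in B)%:R) * (1 + 4 * a ^+ 2)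
  = lambda A * (4 * a * lambda B + (1 - 2 * a) ^+ 2 * (x \in B)%:R).
  by field; rewrite gt_eqF.
move: lAB lA0 lB0; move: (lambda B) => m.
(* If [x] is not in [B], the atom does not count and [l * m <= 1 / 4] suffices; if it is, [A] avoids
   [x] and has length at most [a]. *)
have [xB|xB] := boolP (x \in B); last first.
  move: (lambda A) => l lm l0 m0; rewrite mulr0 addr0.
  have lm4 : l * m <= 1 / 4.
    apply: le_trans (_ : (1 - m) * m <= _); first by rewrite ler_wpM2r.
    by have := sqr_ge0 (m - 1 / 2); lra.
  rewrite (_ : l * _ = 4 * a * (l * m)); last by ring.
  by have := ler_wpM2l a0 lm4; lra.
have Ax : ~ A x.
  move=> Ax; have : (A `&` B) x by split=> //; exact: set_mem xB.
  by rewrite AB.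
have := connected_lambda_le total1 cA Ax; rewrite -/a.
move: (lambda A) => l la lm l0 m0; rewrite mulr1.
apply: le_trans (_ : l * (4 * a * (1 - l) + (1 - 2 * a) ^+ 2) <= a).
  apply: ler_wpM2l => //; rewrite lerD2r; apply: ler_wpM2l; last lra.
  by rewrite mulr_ge0.
(* The second factor of the factorization below; it is nonnegative because [l <= a <= 1 / 2]. *)
have al : 0 <= 1 - 4 * a * l.
  have := ler_wpM2l a0 la; have := ler_wpM2l a0 a2; lra.
rewrite -subr_ge0 (_ : _ - _ = (a - l) * (1 - 4 * a * l)); last by ring.
by rewrite mulr_ge0// subr_ge0.
Qed.

(** * The payoff of the partition strategy *)

Section partition_value.
Context (R : realType) (Q : network R) (x : Q) (n : nat) (C : 'I_n -> set Q).
Hypothesis treeQ : is_tree Q.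
Hypothesis total1 : length_measure [set: Q] = 1%E.
Hypothesis enumC : is_comp_enum x C.
Implicit Types (S : {set 'I_n}) (y : Q).

Let a i := lambda (C i).

Lemma enum_component i : components (~` [set x]) (C i).
Proof. by have [_ <- _] := enumC; exists i. Qed.

Lemma enum_unique y i j : C i y -> C j y -> i = j.
Proof.
move=> iy jy; have [inj _ _] := enumC; apply: inj.
apply: components_disjoint (enum_component i) (enum_component j) _.
by exists y.
Qed.

Lemma enum_cover y : y <> x -> exists i, C i y.
Proof.
move=> yx; have : (~` [set x]) y by [].
rewrite -(components_cover (~` [set x])) => -[E]; have [_ <- _] := enumC.
by move=> [i _ <-] Ciy; exists i.
Qed.

(** The germ of the component at [x] already has positive length. *)
Lemma lambda_component_gt0 i : 0 < a i.
Proof.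
have [eps0 eps00 H] := component_germ treeQ (enum_component i).
have [|G [y [_ _ _ PE Plen]]] := H (eps0 / 2); first lra.
apply: lt_le_trans (le_lambda total1 PE).
by rewrite /lambda Plen /=; lra.
Qed.

Lemma lambda_bigcup_components S :
  lambda (\bigcup_(j in [set j | j \in S]) C j) = \sum_(j in S) a j.
Proof.
apply: EFin_inj; rewrite -lambdaE// -sumEFin.
under eq_bigr do rewrite -lambdaE//.
rewrite -measure_bigsetU_ord.
- by rewrite -bigcup_pred.
- by move=> i; exact: component_measurable (enum_component i).
- by move=> i j _ _ [y [iy jy]]; exact: enum_unique iy jy.
Qed.

Lemma measurable_setC1 : measurable (~` [set x] : set Q).
Proof.
apply: net_open_measurable; rewrite -(components_cover (~` [set x])).
by apply: bigcup_open => E; exact: component_open.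
Qed.

Lemma lambda_components_sum : \sum_i a i = 1.
Proof.
have -> : \sum_i a i = \sum_(i in [set: 'I_n]%SET) a i.
  by apply: eq_bigl => i; rewrite inE.
rewrite -lambda_bigcup_components.
have -> : \bigcup_(j in [set j | j \in [set: 'I_n]%SET]) C j = ~` [set x].
  apply/seteqP; split=> [y [i _ iy]|y yx].
    exact: components_sub (enum_component i) _ iy.
  by have [i iy] := enum_cover yx; exists i => //=; rewrite inE.
have := lambdaC total1 measurable_setC1.
by rewrite setCK /lambda length_measure_set1//=; lra.
Qed.

(** The sets used partition [Q], and each has probability inversely proportional to its length, so
    it adds [1 / D] unless it contains [y]. Exactly one of the [n - #|S| + 1] sets does. *)
Lemma attacker_payoff_partition S y : S != finset.set0 ->
  attacker_payoff (partition_strategy x C S) y = part_W a S.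
Proof.
move=> S0; rewrite /attacker_payoff /partition_strategy -/a big_cons big_map.
rewrite big_enum /=; set U := [set x] `|` _; set D := part_D _ S.
have lU : lambda U = \sum_(j in S) a j.
  rewrite /U lambdaU//.
  - by rewrite lambda_bigcup_components {1}/lambda length_measure_set1// add0r.
  - rewrite -[X in measurable X]setCK; apply: measurableC.
    exact: measurable_setC1.
  - apply: net_open_measurable; apply: bigcup_open => i _.
    exact: component_open (enum_component i).
  - apply/seteqP; split=> // _ [-> [i _ ix]].
    by have /(_ erefl) := components_sub (enum_component i) ix.
have b0 : 0 < \sum_(j in S) a j.
  have /set0Pn[i iS] := S0; rewrite (bigD1 i)//= ltr_pwDl//.
    exact: lambda_component_gt0.
  by apply: sumr_ge0 => j _; exact/ltW/lambda_component_gt0.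
have payE A (c : R) : 0 < c -> lambda A = c ->
    c^-1 / D * payoff A y = (1 - (y \in A)%:R) / D.
  move=> c0 Ac; rewrite /payoff Ac; case: (y \in A) => /=.
    by rewrite subrr mul0r mulr0.
  by rewrite subr0 mulrAC mulVf ?gt_eqF.
rewrite payE//; under eq_bigr do rewrite payE ?lambda_component_gt0//.
rewrite -mulr_suml -mulrDl /part_W; congr (_ / _).
rewrite sumrB sumr_const addrACA -opprD.
have cardS : #|finset.setC S| = (n - #|S|)%N.
  by rewrite cardsCs finset.setCK card_ord.
suff -> : (y \in U)%:R + \sum_(i in finset.setC S) (y \in C i)%:R = 1 :> R.
  by rewrite addrC -cardS; lra.
have [Uy|Uy] := pselect (U y).
  rewrite (mem_set Uy) big1 ?addr0// => i; rewrite inE => iS.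
  rewrite memNset// => iy; case: Uy => [yx|[j jS jy]].
    by have := components_sub (enum_component i) iy; apply.
  by move: iS; rewrite (enum_unique iy jy) jS.
rewrite memNset// add0r.
have [i iy] : exists i, C i y by apply: enum_cover => yx; apply: Uy; left.
have iS : i \in finset.setC S.
  by rewrite inE; apply/negP => iS; apply: Uy; right; exists i.
rewrite (bigD1 i)//= (mem_set iy) big1 ?addr0// => j /andP[_ ji].
rewrite memNset// => jy.
by move: ji; rewrite (enum_unique iy jy) eqxx.
Qed.

End partition_value.

(** * Comparison of the two values *)

Lemma max_comp_enum (R : realType) (Q : network R) (x : Q) (n : nat)
    (C : 'I_n.+1 -> set Q) :
  length_measure [set: Q] = 1%E -> is_comp_enum x C ->
  max_comp x = lambda (C ord0).
Proof.
move=> total1 enumC; apply/le_anti/andP; split; last first.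
  exact: (max_comp_ge total1 (enum_component enumC ord0)).
have [_ rC mono] := enumC; apply: ge_sup.
  by rewrite -rC; exists (lambda (C ord0)), (C ord0) => //; exists ord0.
by rewrite -rC => _ [_ [i _ <-] <-]; exact: mono.
Qed.

(** Opposing the first component to all the others is the competitor that bounds the best [part_W]
    from below. *)
Lemma part_W_first (R : realType) (n : nat) (a : 'I_n.+1 -> R) :
  \sum_i a i = 1 -> a ord0 != 0 -> a ord0 != 1 ->
  part_W a (finset.setC (finset.set1 ord0)) = a ord0 * (1 - a ord0).
Proof.
move=> sum1 a0 a1; rewrite /part_W /part_D cardsC1 card_ord subSnn.
rewrite (big_pred1 ord0); last by move=> i; rewrite !inE negbK.
have -> : \sum_(j in finset.setC (finset.set1 ord0)) a j = 1 - a ord0.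
  rewrite -sum1 [in RHS](bigD1 ord0)//= addrAC subrr add0r.
  by apply: eq_bigl => i; rewrite !inE.
have a1' : 1 - a ord0 != 0 by rewrite subr_eq0 eq_sym.
have -> : (a ord0)^-1 + (1 - a ord0)^-1 = (a ord0 * (1 - a ord0))^-1.
  by field; apply/andP.
by rewrite invrK mul1r.
Qed.

Theorem corollary11 (R : realType) (Q : network R) (x : Q) (n : nat)
    (C : 'I_n -> set Q) (S : {set 'I_n}) :
  is_tree Q ->
  length_measure [set: Q] = 1%E ->
  is_centroid x ->
  is_comp_enum x C ->
  is_best_part (fun i => lambda (C i)) S ->
  let v_up := sup [set defender_payoff (centroid_strategy x) A
                  | A in [set A : set Q | connected A]] in
  let v_lo := inf (range (attacker_payoff (partition_strategy x C S))) in
  0 < v_lo /\ v_up / v_lo <= 27 / 25.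
Proof.
move=> treeQ total1 cx enumC [S0 Sbest] v_up v_lo.
have sum1 := lambda_components_sum treeQ total1 enumC.
(* An empty enumeration would give total length 0, so [ord0] exists. *)
case: n C S enumC S0 Sbest sum1 @v_lo => [|n] C S enumC S0 Sbest sum1 v_lo.
  by move: sum1; rewrite big_ord0 => /esym/eqP; rewrite oner_eq0.
have v_loE : v_lo = part_W (fun i => lambda (C i)) S.
  rewrite /v_lo (_ : range _ = [set part_W (fun i => lambda (C i)) S]) ?inf1//.
  apply/seteqP; split=> [_ [y _ <-]|_ ->]; rewrite /=.
    exact: attacker_payoff_partition.
  by exists x => //; exact: attacker_payoff_partition.
pose a := lambda (C ord0).
have a0 : 0 < a := lambda_component_gt0 treeQ total1 enumC ord0.
have a2 : a <= 1 / 2.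
  exact: centroid_component_le_half (enum_component enumC ord0).
have maxE := max_comp_enum total1 enumC; rewrite -/a in maxE.
have first_le : a * (1 - a) <= v_lo.
  have a1 : a < 1 by lra.
  rewrite v_loE -(part_W_first sum1) ?(gt_eqF a0) ?(lt_eqF a1)//.
  (* The competing index set is nonempty: a sole component would have length 1, against
     [a <= 1 / 2]. *)
  apply: Sbest; rewrite -card_gt0 cardsC1 card_ord lt0n.
  apply/eqP => /= n0; move: a2; rewrite /a; clear -sum1 n0; subst n.
  by move: sum1; rewrite big_ord1 => ->; lra.
have v_lo0 : 0 < v_lo by apply: lt_le_trans first_le; rewrite mulr_gt0//; lra.
split=> //; rewrite ler_pdivrMr//.
apply: le_trans (_ : 27 / 25 * (a * (1 - a)) <= _); last by rewrite ler_pM2l.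
have d0 : 0 < 1 + 4 * a ^+ 2 by nra.
apply: le_trans (_ : a / (1 + 4 * a ^+ 2) <= _).
  apply: ge_sup.
    by exists (defender_payoff (centroid_strategy x) set0), set0 => //;
      exact: connected0.
  move=> _ [A cA <-]; rewrite -maxE; apply: defender_payoff_le => //.
  by rewrite maxE.
rewrite ler_pdivrMr// -subr_ge0.
(* The double root at [a = 1 / 6] makes 27/25 the least constant for which this difference stays
   nonnegative. *)
have -> : 27 / 25 * (a * (1 - a)) * (1 + 4 * a ^+ 2) - a
    = 108 / 25 * a * (a - 1 / 6) ^+ 2 * (2 / 3 - a) by field.
by apply: mulr_ge0; [apply: mulr_ge0; [lra|exact: sqr_ge0]|lra].
Qed.
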